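(* Let $m\ge1$ and let $G_1,\dots,G_m$ be graphs each of which is either a clique $K_n$ (for some $n\ge1$) or a cycle $C_a$ (for some $a\ge2$). Then the adjacent cycle+clique chain $G_1+G_2+\cdots+G_m$ is $e$-positive.
   Context: $K_n$ is the graph on $\{1,\dots,n\}$ with an edge between every pair of distinct vertices. $C_a$ is the cycle graph on $\{1,\dots,a\}$ with edges $(1,2),(2,3),\dots,(a-1,a),(a,1)$ (for $a=2$ this is a single edge). If $G_1,G_2$ are graphs with vertices labeled $1,\dots,k_1$ and $1,\dots,k_2$, then $G_1+G_2$ is the graph on $\{1,\dots,k_1+k_2-1\}$ with edge set $E(G_1)\cup\{(i+k_1-1,j+k_1-1):(i,j)\in E(G_2)\}$, i.e. the last vertex of $G_1$ is identified with the first vertex of $G_2$; this operation is associative. The chromatic symmetric function of a graph $G$ with $n$ vertices is $X_G(\boldsymbol{x})=\sum_\kappa\prod_{v\in V(G)}x_{\kappa(v)}$, summed over proper colorings $\kappa:V(G)\to\mathbb{N}$, in infinitely many variables $\boldsymbol{x}=(x_i)_{i\in\mathbb{N}}$. $e_k=\sum_{i_1<\cdots<i_k}x_{i_1}\cdots x_{i_k}$ and $e_\lambda=\prod_i e_{\lambda_i}$ for a partition $\lambda$. $X_G$ is uniquely a linear combination $\sum_\lambda c_\lambda e_\lambda$ over partitions $\lambda$ of $n$, and $G$ is $e$-positive if all $c_\lambda\ge0$. *)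

(* Defs.v *)
From HB Require Import structures.
From mathcomp Require Import all_boot all_order all_algebra finmap.
From mathcomp Require Import boolp classical_sets functions cardinality fsbigop.
From mathcomp Require Import monalg.

Set Implicit Arguments.
Unset Strict Implicit.
Unset Printing Implicit Defensive.

Import Order.TTheory GRing.Theory Num.Theory.
Local Open Scope classical_set_scope.
Local Open Scope ring_scope.

(* Finite simple graphs with labelled vertices. The label i in {1, ..., n} is
   the ordinal of value i - 1. *)
Record lgraph := LGraph {
  gorder : nat;
  adj : rel 'I_gorder;
  adj_sym : symmetric adj;
  adj_irr : irreflexive adj
}.

Section Complete.
Variable n : nat.
Definition complete_adj : rel 'I_n := fun i j => i != j.

Fact complete_sym : symmetric complete_adj.
Proof. by move=> i j; rewrite /complete_adj eq_sym. Qed.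

Fact complete_irr : irreflexive complete_adj.
Proof. by move=> i; rewrite /complete_adj eqxx. Qed.

Definition complete_graph : lgraph := LGraph complete_sym complete_irr.
End Complete.

Section Cycle.
Variable a : nat.
(* [ordS] is the successor modulo a. For a = 2 this is a single edge. *)
Definition cycle_adj : rel 'I_a :=
  fun i j => (i != j) && ((j == ordS i) || (i == ordS j)).

Fact cycle_sym : symmetric cycle_adj.
Proof. by move=> i j; rewrite /cycle_adj eq_sym orbC. Qed.

Fact cycle_irr : irreflexive cycle_adj.
Proof. by move=> i; rewrite /cycle_adj eqxx. Qed.

Definition cycle_graph : lgraph := LGraph cycle_sym cycle_irr.
End Cycle.

Section GraphSum.
Variables G1 G2 : lgraph.
Definition gsum_adj : rel 'I_(gorder G1 + gorder G2).-1 := fun u v =>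
  [exists i : 'I_(gorder G1), exists j : 'I_(gorder G1),
     [&& adj i j, u == i :> nat & v == j :> nat]]
  || [exists i : 'I_(gorder G2), exists j : 'I_(gorder G2),
     [&& adj i j, u == (i + (gorder G1).-1)%N :> nat
               & v == (j + (gorder G1).-1)%N :> nat]].

Fact gsum_sym : symmetric gsum_adj.
Proof.
have half u v : gsum_adj u v -> gsum_adj v u.
  case/orP=> /existsP[i /existsP[j /and3P[Eij eu ev]]]; apply/orP.
    by left; apply/existsP; exists j; apply/existsP; exists i;
       rewrite adj_sym Eij eu ev.
  by right; apply/existsP; exists j; apply/existsP; exists i;
     rewrite adj_sym Eij eu ev.
by move=> u v; apply/idP/idP; apply: half.
Qed.

Fact gsum_irr : irreflexive gsum_adj.
Proof.
move=> u; apply/negbTE/negP.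
case/orP=> /existsP[i /existsP[j /and3P[Eij /eqP eu]]].
  by rewrite eu => /eqP/val_inj ij; rewrite ij adj_irr in Eij.
by rewrite eu eqn_add2r => /eqP/val_inj ij; rewrite ij adj_irr in Eij.
Qed.

Definition gsum : lgraph := LGraph gsum_sym gsum_irr.
End GraphSum.

(* The sum is bracketed to the left. The value on the empty sequence is a
   convention. *)
Definition gchain (Gs : seq lgraph) : lgraph :=
  if Gs is G :: Gs' then foldl gsum G Gs' else complete_graph 1.

Definition clique_or_cycle (G : lgraph) : Prop :=
  (exists2 n, (1 <= n)%N & G = complete_graph n) \/
  (exists2 a, (2 <= a)%N & G = cycle_graph a).

(* Formal power series over the rationals in the variables x_0, x_1, ...,
   given by their coefficients. *)
Notation xmonomial := {cmonom nat}.
Definition fps := xmonomial -> rat.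

Definition fps_one : fps := fun m => (m == mone)%:R.

Definition fps_mul (f g : fps) : fps := fun m =>
  \sum_(p \in [set p : xmonomial * xmonomial | mmul p.1 p.2 = m]) f p.1 * g p.2.

(* The formal sum of the monomials w i for i in A. It is the actual sum when
   every monomial occurs finitely often. The lemmas [finite_colorings],
   [finite_subsets], [finite_divisors] and [finite_partitions] below show
   that every finitely supported sum in this file is indeed one. *)
Definition fps_sum (I : choiceType) (A : set I) (w : I -> xmonomial) : fps :=
  fun m => \sum_(i \in A) ((w i == m)%:R : rat).

Definition proper_coloring (G : lgraph) (k : {ffun 'I_(gorder G) -> nat}) :=
  forall u v, adj u v -> k u != k v.

Definition coloring_monomial (G : lgraph) (k : {ffun 'I_(gorder G) -> nat}) :=
  \big[mmul/mone]_(v < gorder G) (ucm (k v) : xmonomial).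

Definition chromatic (G : lgraph) : fps :=
  fps_sum [set k | @proper_coloring G k] (@coloring_monomial G).

Definition subset_monomial (S : {fset nat}) : xmonomial :=
  \big[mmul/mone]_(i <- S) ucm i.

Definition elementary (k : nat) : fps :=
  fps_sum [set S : {fset nat} | #|` S| = k] subset_monomial.

Definition is_partition (n : nat) (l : seq nat) : bool :=
  [&& sorted geq l, all (leq 1) l & sumn l == n].

Definition elementary_part (l : seq nat) : fps :=
  foldr fps_mul fps_one (map elementary l).

Definition e_combination (n : nat) (c : seq nat -> rat) : fps := fun m =>
  \sum_(l \in [set l | is_partition n l]) c l * elementary_part l m.

Definition e_positive (G : lgraph) : Prop :=
  exists c : seq nat -> rat,
    chromatic G = e_combination (gorder G) c /\
    (forall l, is_partition (gorder G) l -> 0 <= c l).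

Lemma prod_ucmE (I : eqType) (r : seq I) (f : I -> nat) (x : nat) :
  (\big[mmul/mone]_(i <- r) (ucm (f i) : xmonomial)) x = count (fun i => f i == x) r.
Proof.
elim: r => [|i r IH]; first by rewrite big_nil cm1.
by rewrite big_cons cmM IH cmU.
Qed.

Lemma finite_colorings (G : lgraph) (m : xmonomial) :
  finite_set [set k : {ffun 'I_(gorder G) -> nat} | coloring_monomial k = m].
Proof.
pose D := finsupp m.
pose h (g : {ffun 'I_(gorder G) -> D}) := [ffun v => val (g v)].
apply: (@sub_finite_set _ _ (h @` setT)); last exact: finite_image.
move=> k /= Ek.
have kD v : k v \in D.
  rewrite /D -cmE_neq0 -Ek prod_ucmE -lt0n -has_count.
  by apply/hasP; exists v; rewrite ?mem_index_enum.
exists [ffun v => [` kD v]%fset] => //.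
by apply/ffunP => v; rewrite !ffunE.
Qed.

Lemma finite_subsets (m : xmonomial) :
  finite_set [set S : {fset nat} | subset_monomial S = m].
Proof.
apply: (@sub_finite_set _ _ [set` fpowerset (finsupp m)]); last first.
  exact: finite_fset.
move=> S /= ES; rewrite fpowersetE; apply/fsubsetP => i iS.
rewrite -cmE_neq0 -ES (prod_ucmE _ id) -lt0n -has_count.
by apply/hasP; exists i.
Qed.

Lemma finite_divisors (m : xmonomial) :
  finite_set [set p : xmonomial * xmonomial | mmul p.1 p.2 = m].
Proof.
pose D := finsupp m; pose N := (\max_(i : D) m (val i)).+1.
pose g (u : {ffun D -> 'I_N}) : xmonomial :=
  [cmonom (oapp (fun i : D => u i : nat) 0 (insub i)) | i in D]%M.
pose h (p : {ffun D -> 'I_N} * {ffun D -> 'I_N}) := (g p.1, g p.2).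
have gP (u : xmonomial) : (forall i, u i <= m i)%N -> exists v, g v = u.
  move=> le_um; exists [ffun i => inord (u (val i))].
  apply/eqP/cmP => i; rewrite cmE fsfun_fun.
  case: ifPn => [iD|]; last first.
    rewrite -cmE_eq0 => /eqP mi0; move: (le_um i).
    by rewrite mi0 leqn0 => /eqP.
  rewrite insubT /= ffunE inordK //= ltnS.
  exact: leq_trans (le_um i) (@leq_bigmax _ (fun i : D => m (val i)) [` iD]%fset).
apply: (@sub_finite_set _ _ (h @` setT)); last exact: finite_image.
case=> a b /= Eab.
have [|u gu] := gP a; first by move=> i; rewrite -Eab cmM leq_addr.
have [|v gv] := gP b; first by move=> i; rewrite -Eab cmM leq_addl.
by exists (u, v) => //; rewrite /h gu gv.
Qed.

Lemma finite_partitions (n : nat) :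
  finite_set [set l | is_partition n l].
Proof.
pose h (t : n.-bseq 'I_n.+1) : seq nat := [seq val x | x <- t].
apply: (@sub_finite_set _ _ (h @` setT)); last exact: finite_image.
move=> l /and3P[_ pos /eqP sl].
have szl : (size l < n.+1)%N.
  rewrite ltnS -sl; elim: l pos {sl} => //= x l IH /andP[x0 /IH].
  by rewrite -add1n; apply: leq_add.
have lel i : (nth 0%N l i <= n)%N.
  rewrite -sl; elim: l {pos sl szl} i => [|x l IH] [|i] //=; first exact: leq_addr.
  exact: leq_trans (IH i) (leq_addl _ _).
have szt : (size [seq inord x : 'I_n.+1 | x <- l] <= n)%N by rewrite size_map.
exists (Bseq szt) => //; rewrite /h /= -map_comp -[RHS]map_id.
apply/eq_in_map => x /(nthP 0%N)[i _ <-] /=.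
by rewrite inordK // ltnS.
Qed.

(* Main.v *)
(** Fix a last vertex in every graph and let X_G(j) be the sum over the proper
    colorings in which this vertex has color j. Such functions are linear
    combinations, over the symmetric functions, of the pointed elementary
    functions E_k(j), the part of e_k made of the monomials that contain x_j.
    Call G pointed e-positive if the coefficients are e-positive; as the E_k(j)
    sum to k e_k over j, this implies e-positivity. Gluing a graph H at the
    last vertex is the application of a linear transfer operator, so it
    suffices that the operators of cycles and cliques send each E_k to a
    pointed e-positive function.

    For a path the operator A satisfies
    A E_k = E_(k+1) + (k-1) e_k E_1. A coloring of the cycle C_(b+1) is a
    coloring of a path with distinct end colors, hence its operator is
    f |-> A^b f - f Q_b, with Q_b the pointed function of C_b. The relation
    E_(k+1) = x (e_k - E_k) gives
    E_a E_b = sum_(1 <= s <= a) (e_(a+b-s) E_s - e_(s-1) E_(a+b+1-s)),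
    and every negative term of f Q_b is then dominated by a term of A^b f. The
    operators of cliques obey a recursion on the order, whose solution involves
    the same cancellation.

    Finitely many variables suffice, because the coefficient of a monomial only
    depends on the variables that occur in it. *)

Require Import Defs.
From mathcomp Require Import boolp classical_sets fsbigop.
From mathcomp Require Import finmap monalg.
From mathcomp Require Import all_boot all_order all_algebra ring zify.

Set Implicit Arguments.
Unset Strict Implicit.
Unset Printing Implicit Defensive.

Import GRing.Theory Num.Theory.
Local Open Scope ring_scope.

(** * Elementary and pointed elementary polynomials *)

Section ElementaryPolynomials.
Variables (R : comNzRingType) (I : finType) (x : I -> R).
Implicit Types (B : {set I}) (i j l : I).

(** [B] is a set of forbidden colors, such as those of the ends of a clique. *)
Definition elem B r : R :=
  \sum_(A : {set I} | (#|A| == r) && [disjoint A & B]) \prod_(i in A) x i.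

Fact disjoint_insert (A B : {set I}) l :
  [disjoint A & l |: B] = (l \notin A) && [disjoint A & B].
Proof.
by rewrite !disjoints_subset setCU subsetI -disjoints_subset disjoint_sym
           disjoints1.
Qed.

Lemma sum_elem_in B r l : l \notin B ->
  \sum_(A : {set I} | [&& #|A| == r.+1, [disjoint A & B] & l \in A])
    \prod_(i in A) x i = x l * elem (l |: B) r.
Proof.
move=> lB; rewrite /elem big_distrr /=.
rewrite (reindex_onto (fun A => l |: A) (fun A => A :\ l)) /=; last first.
  by move=> A /and3P[_ _ lA]; rewrite setD1K.
apply: eq_big => [A|A].
  have [lA|lA] := boolP (l \in A).
    have -> : (l |: A) :\ l == A = false.
      by apply/eqP => /setP/(_ l); rewrite lA !inE eqxx.
    by rewrite !andbF disjoint_sym disjoints_subset subUset sub1set !inE lA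
               /= andbF.
  rewrite cardsU1 lA setU1K // eqxx !inE eqxx !andbT /= add1n eqSS.
  by rewrite disjoint_insert lA /= ![[disjoint _ & B]]disjoint_sym disjoint_insert lB.
case/andP=> /and3P[_ _ _] /eqP AE.
have lA : l \notin A by rewrite -AE !inE eqxx.
by rewrite big_setU1.
Qed.

Lemma elem_split B r l : l \notin B ->
  elem B r.+1 = elem (l |: B) r.+1 + x l * elem (l |: B) r.
Proof.
move=> lB; rewrite -sum_elem_in // addrC {1}/elem (bigID (fun A : {set I} => l \in A)) /=.
congr (_ + _); first by apply: eq_bigl => A; rewrite andbA.
apply: eq_bigl => A; rewrite -andbA; congr andb.
by rewrite disjoint_insert andbC.
Qed.

(** Double counting: a set of size [r.+1] arises once for each of its elements [l]. *)
Lemma sum_elem B r :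
  \sum_(l | l \notin B) x l * elem (l |: B) r = elem B r.+1 *+ r.+1.
Proof.
under eq_bigr => l lB do rewrite -sum_elem_in //.
rewrite (exchange_big_dep (fun A : {set I} => (#|A| == r.+1) && [disjoint A & B])) /=;
  last by move=> l A _ /and3P[-> ->].
rewrite /elem -sumrMnl; apply: eq_bigr => A /andP[/eqP sA dA].
rewrite -sA -sumr_const; apply: eq_bigl => l; rewrite sA eqxx dA /=.
by apply: andb_idl => lA; apply/negbT; exact: disjointFr dA lA.
Qed.


Definition esym (r : nat) : R := elem set0 r.

Definition pointed_esym r i : R := if r is r'.+1 then x i * elem [set i] r' else 0.

Arguments esym r%_N.
Arguments pointed_esym r%_N i.
Local Notation e := esym.
Local Notation E := pointed_esym.

Lemma elem0 B : elem B 0 = 1.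
Proof.
rewrite /elem (big_pred1 set0) ?big_set0 // => A /=.
by rewrite cards_eq0; case: eqP => //= ->; rewrite -setI_eq0 set0I eqxx.
Qed.

(** Because [e r - E r i] is the part of [e r] free of [x i]. *)
Lemma pointed_esymS r i : E r.+1 i = x i * (e r - E r i).
Proof.
case: r => [|r] /=; first by rewrite /e !elem0 subr0.
by rewrite /e (@elem_split set0 r i) ?inE // setU0 addrK.
Qed.

Lemma mul_var_pointed_esym r i : x i * E r i = e r * x i - E r.+1 i.
Proof. by rewrite pointed_esymS; ring. Qed.

Lemma sum_pointed_esym r : \sum_i E r i = e r *+ r.
Proof.
case: r => [|r] /=; first by rewrite big1 ?mulr0n.
rewrite /e -sum_elem; apply: eq_big => i; first by rewrite inE.
by rewrite setU0.
Qed.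

(** By [pointed_esymS], the difference of [E a.+1 * E b] and [E a * E b.+1] contains no product of
    two pointed factors. Units thus move from [a] to [b] until [E 0 = 0] is reached. *)
Lemma pointed_esymM a b i : E a i * E b i =
  \sum_(s < a) (e (a + b - s.+1) * E s.+1 i - e s * E (a + b - s) i).
Proof.
elim: a b => [|a IH] b; first by rewrite big_ord0 mul0r.
rewrite big_ord_recr /= addKn addSnnS addKn.
have -> : E a.+1 i * E b i =
    E a i * E b.+1 i + (e b * E a.+1 i - e a * E b.+1 i).
  by rewrite !pointed_esymS; ring.
by rewrite IH.
Qed.

Lemma pointed_esym1 i : E 1 i = x i.
Proof. by rewrite /= elem0 mulr1. Qed.

Arguments pointed_esym : simpl never.

(** * Transfer operators of paths *)

Definition path_step (f : I -> R) l : R := x l * \sum_(i | i != l) f i.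

Lemma path_stepE f l : path_step f l = x l * (\sum_i f i - f l).
Proof. by rewrite [in RHS](bigD1 l) //= addrAC subrr add0r. Qed.

Lemma path_step_sum (J : finType) (f : J -> I -> R) (c : J -> R) l :
  path_step (fun i => \sum_j f j i * c j) l = \sum_j path_step (f j) l * c j.
Proof.
rewrite /path_step exchange_big mulr_sumr; apply: eq_bigr => j _.
by rewrite -mulr_suml mulrA.
Qed.

Lemma path_stepD f g l :
  path_step (fun i => f i + g i) l = path_step f l + path_step g l.
Proof. by rewrite /path_step big_split mulrDr. Qed.

Lemma path_stepZ c f l : path_step (fun i => c * f i) l = c * path_step f l.
Proof. by rewrite /path_step -mulr_sumr mulrCA. Qed.

Lemma eq_path_step f g : f =1 g -> path_step f =1 path_step g.
Proof. by move=> fg l; congr (_ * _); apply: eq_bigr. Qed.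

Lemma eq_iter_path_step b f g : f =1 g -> iter b path_step f =1 iter b path_step g.
Proof. by move=> fg; elim: b => //= b; apply: eq_path_step. Qed.

(** Summing [E k.+1] gives [k.+1] copies of [e k.+1]; one of them merges with [- E k.+1 l] into
    [E k.+2 l]. *)
Lemma path_step_pointed_esym k l :
  path_step (E k.+1) l = E k.+2 l + (e k.+1 * E 1 l) *+ k.
Proof.
rewrite path_stepE sum_pointed_esym [E k.+2 l]pointed_esymS pointed_esym1.
by ring.
Qed.

(* The sequence c_n, ..., c_0, where c_n is the sum of
   prod_i (a_i - 1) e_(a_i) over the compositions a of n. *)
Fixpoint path_coefs n : seq R :=
  if n is n'.+1 then
    let cs := path_coefs n' in
    (\sum_(i < n) (e i.+1 * cs`_i) *+ i) :: cs
  else [:: 1].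

Definition path_coef n : R := (path_coefs n)`_0.
Arguments path_coef n%_N.
Local Notation c := path_coef.

Lemma nth_path_coefs (n i : nat) : (i <= n)%N -> (path_coefs n)`_i = c (n - i).
Proof. by elim: n i => [|n IH] [|i] //=; rewrite ltnS subSS; apply: IH. Qed.

Lemma path_coefS n : c n.+1 = \sum_(i < n.+1) (e i.+1 * c (n - i)) *+ i.
Proof. by apply: eq_bigr => i _; rewrite -nth_path_coefs // -ltnS. Qed.

(** A step raises the index of each [E m.+1]; the multiples of [E 1] that it also creates add up to
    the recursion [path_coefS]. *)
Lemma iter_path_step_var b l :
  iter b path_step (E 1) l = \sum_(m < b.+1) E m.+1 l * c (b - m).
Proof.
elim: b l => [|b IH] l; first by rewrite big_ord1 /= mulr1.
rewrite iterS (eq_path_step IH) path_step_sum.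
rewrite [RHS]big_ord_recl subn0 path_coefS mulr_sumr -big_split.
apply: eq_bigr => m _; rewrite path_step_pointed_esym /= /bump /= subSS.
by ring.
Qed.

Lemma iter_path_stepD b f g l : iter b path_step (fun i => f i + g i) l =
  iter b path_step f l + iter b path_step g l.
Proof.
elim: b l => //= b IH l; rewrite (eq_path_step IH).
exact: path_stepD.
Qed.

Lemma iter_path_stepZ b a f l :
  iter b path_step (fun i => a * f i) l = a * iter b path_step f l.
Proof. by elim: b l => //= b IH l; rewrite (eq_path_step IH) path_stepZ. Qed.

(** Step [r], counted from 0, moves the leading term up by one index and leaves a multiple of [E 1],
    on which the other [b - r.+1] steps act. *)
Lemma iter_path_step_pointed_esym b k l : iter b path_step (E k.+1) l =
  E (k + b).+1 l +
  \sum_(r < b) (e (k + r).+1 * iter (b - r.+1) path_step (E 1) l) *+ (k + r).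
Proof.
elim: b k => [|b IH] k; first by rewrite big_ord0 addr0 addn0.
rewrite iterSr (@eq_iter_path_step _ _
  (fun l => E k.+2 l + (e k.+1 *+ k) * E 1 l)); last first.
  by move=> i; rewrite path_step_pointed_esym mulrnAl.
rewrite iter_path_stepD iter_path_stepZ IH big_ord_recl addn0 subSS subn0.
rewrite addSnnS mulrnAl -addrA; congr (_ + _).
rewrite addrC; congr (_ + _); apply: eq_bigr => r _.
by rewrite /= /bump /= subSS add1n addSnnS.
Qed.

Lemma sum_triangle (b : nat) (F : nat -> nat -> R) :
  \sum_(r < b) \sum_(m < b - r) F r m =
  \sum_(j < b) \sum_(m < j.+1) F (j - m)%N m.
Proof.
elim: b => [|b IH]; first by rewrite !big_ord0.
rewrite [RHS]big_ord_recr -IH [in LHS]big_ord_recr /= subSnn big_ord1.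
rewrite (eq_bigr (fun r : 'I_b => \sum_(m < b - r) F r m + F r (b - r)%N)).
  rewrite big_split -addrA; congr (_ + _).
  rewrite [RHS](reindex_inj rev_ord_inj) /= [RHS]big_ord_recr /= subSS subnn subn0.
  congr (_ + _); apply: eq_bigr => r _ /=.
  by rewrite subSS subKn // ltnW.
by move=> r _; rewrite subSn 1?ltnW // big_ord_recr.
Qed.

(** The reversal [m -> k + j.+1 - m] of the range [k < m <= j] matches the terms; outside this range
    both multiplicities vanish. *)
Lemma sum_reflect (k j : nat) l :
  \sum_(m < j.+1) (e (k + j.+1 - m) * E m.+1 l) *+ (m - k) =
  \sum_(m < j.+1) (e m * E (k + j.+2 - m) l) *+ ((k < m) * (j.+1 - m)).
Proof.
rewrite -(big_mkord xpredT (fun m => (e (k + j.+1 - m) * E m.+1 l) *+ (m - k))).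
rewrite -(big_mkord xpredT
  (fun m => (e m * E (k + j.+2 - m) l) *+ ((k < m) * (j.+1 - m)))).
have [jk|kj] := ltnP j k.
  rewrite !big_nat !big1 // => m /andP[_ mj].
    by rewrite ltnNge (_ : (m <= k)%N) //; lia.
  by have -> : (m - k = 0)%N by lia.
rewrite [LHS](big_cat_nat _ (n := k.+1)) // [RHS](big_cat_nat _ (n := k.+1)) //; congr (_ + _).
  rewrite !big_nat !big1 // => m /andP[_ mj].
    by rewrite ltnNge (_ : (m <= k)%N) //; lia.
  by have -> : (m - k = 0)%N by lia.
rewrite big_nat_rev /= !big_nat; apply: eq_bigr => m /andP[km mj].
rewrite km mul1n.
have -> : (k.+1 + j.+1 - m.+1 - k = j.+1 - m)%N by lia.
have -> : (k + j.+1 - (k.+1 + j.+1 - m.+1) = m)%N by lia.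
by have -> : ((k.+1 + j.+1 - m.+1).+1 = k + j.+2 - m)%N by lia.
Qed.

(* The left-hand side is what remains of a transfer operator after the product
   formula. The terms with [m > k] have a negative coefficient [k - m]; they are
   absorbed by the second summand through [sum_reflect]. *)
Lemma sum_pointed_esym_sub (k j : nat) (a : nat -> nat) l :
  (forall m, (k < m <= j)%N -> (j.+1 - m <= a m)%N) ->
  \sum_(m < j.+1) ((e (k + j.+1 - m) * E m.+1 l) *+ k -
     (e (k + j.+1 - m) * E m.+1 l) *+ m + (e m * E (k + j.+2 - m) l) *+ a m) =
  \sum_(m < j.+1) ((e (k + j.+1 - m) * E m.+1 l) *+ (k - m) +
    (e m * E (k + j.+2 - m) l) *+ (a m - (k < m) * (j.+1 - m))).
Proof.
move=> le_a; apply/eqP; rewrite -subr_eq0 -sumrB; apply/eqP.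
under eq_bigr => m _.
  rewrite (_ : _ - _ = (e m * E (k + j.+2 - m) l) *+ ((k < m) * (j.+1 - m)) -
    (e (k + j.+1 - m) * E m.+1 l) *+ (m - k)); first over.
  have le_am : ((k < m) * (j.+1 - m) <= a m)%N.
    by case: ltnP => // km; rewrite mul1n le_a // km -ltnS ltn_ord.
  rewrite [_ *+ (a m - _)]mulrnBr //.
  have -> : forall y : R, y *+ k - y *+ m = y *+ (k - m) - y *+ (m - k).
    move=> y; have [mk|/ltnW km] := leqP m k.
      by rewrite mulrnBr // (_ : (m - k = 0)%N) ?subr0 //; apply/eqP.
    by rewrite [y *+ (m - k)]mulrnBr // (_ : (k - m = 0)%N) ?sub0r ?opprB //; apply/eqP.
  by ring.
by rewrite sumrB sum_reflect subrr.
Qed.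

(* The pointed chromatic function of the cycle with [b] vertices, and 0 for
   b = 1; for b = 0 it is a junk value. *)
Definition cycle_pointed b i := \sum_(j < b) (E j.+1 i * c (b - j.+1)) *+ j.

(** Deletion-contraction of an edge: from the path colorings those with equal ends are removed, and
    merging the ends gives a shorter cycle. *)
Lemma cycle_pointedS b l :
  cycle_pointed b.+2 l = iter b.+1 path_step (E 1) l - x l * cycle_pointed b.+1 l.
Proof.
apply/eqP; rewrite eq_sym subr_eq; apply/eqP; rewrite /cycle_pointed.
rewrite iter_path_step_var mulr_sumr.
rewrite [LHS]big_ord_recl [X in _ = X + _]big_ord_recl mulr0n add0r subn0.
rewrite path_coefS mulr_sumr -!big_split; apply: eq_bigr => i _ /=.
rewrite /bump /= add1n !subSS pointed_esym1 [E i.+2 l]pointed_esymS.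
by ring.
Qed.

(** Subtracting [j] times the product formula turns the weight [k + (j - m)] of a path term into
    [k - m] and adds [j] times [e m * E (k + j.+2 - m) l]. Negative [k - m] are left to
    [sum_pointed_esym_sub]. *)
Lemma cycle_step_pointed_esym b k l :
  iter b path_step (E k.+1) l - E k.+1 l * cycle_pointed b l =
  E (k + b).+1 l + \sum_(j < b) c (b - j.+1) * \sum_(m < j.+1)
    ((e (k + j.+1 - m) * E m.+1 l) *+ (k - m) +
     (e m * E (k + j.+2 - m) l) *+ (j - (k < m) * (j.+1 - m))).
Proof.
rewrite iter_path_step_pointed_esym -addrA; congr (_ + _).
under eq_bigr => r _ do rewrite iter_path_step_var subnSK // mulr_sumr -sumrMnl.
(* With [j = r + m] the path terms carry the same factor [c (b - j.+1)] as the terms of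
   [cycle_pointed]. *)
rewrite (sum_triangle b (fun r m : nat =>
  e (k + r).+1 * (E m.+1 l * c (b - r.+1 - m)) *+ (k + r))).
rewrite /cycle_pointed mulr_sumr -sumrB; apply: eq_bigr => j _.
(* The constant weight [j] absorbs enough because [k < m] forces [m >= 1]. *)
rewrite -(@sum_pointed_esym_sub k j (fun=> j)); last by move=> m; lia.
rewrite (_ : _ * _ = c (b - j.+1) * (E j.+1 l * E k.+1 l *+ j)); last by ring.
rewrite pointed_esymM -sumrMnl !mulr_sumr -sumrB; apply: eq_bigr => m _.
have mj : (m <= j)%N by rewrite -ltnS.
have -> : (b - (j - m).+1 - m = b - j.+1)%N by lia.
have -> : ((k + (j - m)).+1 = k + j.+1 - m)%N by lia.
have -> : (j.+1 + k.+1 - m.+1 = k + j.+1 - m)%N by lia.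
have -> : (j.+1 + k.+1 - m = k + j.+2 - m)%N by lia.
have -> : forall y : R, y *+ (k + (j - m)) = y *+ k - y *+ m + y *+ j.
  by move=> y; rewrite mulrnDr mulrnBr //; ring.
by ring.
Qed.

(* Up to the factor r!, the operator of the clique with [r.+2] vertices: the
   [r] inner vertices avoid the colors of both ends. *)
Definition clique_step r (f : I -> R) l : R :=
  x l * \sum_(i | i != l) f i * elem [set i; l] r.
Local Notation U := clique_step.

Lemma clique_step0 f : clique_step 0 f =1 path_step f.
Proof.
by move=> l; congr (_ * _); apply: eq_bigr => i _; rewrite elem0 mulr1.
Qed.

(** In the product the inner vertices avoid only the color [l]; by [elem_split] the excess is where
    one of them takes the color [i] of the other end. *)
Lemma clique_stepS r f l : clique_step r.+1 f l =
  E r.+2 l * (\sum_i f i - f l) - clique_step r (fun i => x i * f i) l.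
Proof.
rewrite (bigD1 l) //= [X in X - f l]addrC addrK /clique_step -mulrA -mulrBr.
congr (_ * _); rewrite mulr_sumr -sumrB; apply: eq_bigr => i il.
rewrite (@elem_split [set l] r i) ?inE //.
by ring.
Qed.

Lemma clique_stepZ r a f l :
  clique_step r (fun i => a * f i) l = a * clique_step r f l.
Proof.
rewrite /clique_step mulrCA; congr (_ * _); rewrite mulr_sumr.
by apply: eq_bigr => i _; rewrite mulrA.
Qed.

Lemma clique_stepB r f g l :
  clique_step r (fun i => f i - g i) l = clique_step r f l - clique_step r g l.
Proof.
rewrite /clique_step -mulrBr -sumrB; congr (_ * _).
by apply: eq_bigr => i _; rewrite mulrBl.
Qed.

Lemma eq_clique_step r f g : f =1 g -> clique_step r f =1 clique_step r g.
Proof. by move=> fg l; congr (_ * _); apply: eq_bigr => i _; rewrite fg. Qed.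

Lemma clique_step_var r l : clique_step r x l = E r.+2 l *+ r.+1.
Proof.
rewrite /clique_step /= /pointed_esym -mulrnAr -sum_elem; congr (_ * _).
by apply: eq_bigl => i; rewrite inE.
Qed.

(** By [mul_var_pointed_esym], lowering the order of the clique raises the index [k]. *)
Lemma clique_step_recl r k l : clique_step r.+1 (E k) l =
  clique_step r (E k.+1) l +
  (e k * E r.+2 l) *+ k - (e k * E r.+2 l) *+ r.+1 - E r.+2 l * E k l.
Proof.
rewrite clique_stepS sum_pointed_esym.
rewrite (@eq_clique_step _ _ (fun i => e k * x i - E k.+1 i)); last first.
  by move=> i; rewrite mul_var_pointed_esym.
by rewrite clique_stepB clique_stepZ clique_step_var; ring.
Qed.

(** Induction on [r] for all [k]: subtracting the product formula lowers the weights [k.+1 - m] to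
    [k - m] and raises [r.+1 - m] to [r.+2 - m]. *)
Lemma clique_step_pointed_esym_int r k l : clique_step r (E k.+1) l =
  \sum_(m < r.+1) ((e (k + r.+1 - m) * E m.+1 l) *+ k -
    (e (k + r.+1 - m) * E m.+1 l) *+ m +
    (e m * E (k + r.+2 - m) l) *+ (r.+1 - m)).
Proof.
elim: r k => [|r IH] k.
  rewrite clique_step0 path_step_pointed_esym big_ord1 /= !subn0 !addn1 !addn2.
  by rewrite /e elem0; ring.
rewrite clique_step_recl IH pointed_esymM !(addSnnS k).
rewrite [X in _ - X]big_ord_recr [RHS]big_ord_recr /=.
have -> : (r.+2 + k.+1 - r.+2 = k.+1)%N by lia.
have -> : (k + r.+2 - r.+1 = k.+1)%N by lia.
have -> : (r.+2 + k.+1 - r.+1 = k.+2)%N by lia.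
have -> : (k + r.+3 - r.+1 = k.+2)%N by lia.
have -> : (r.+2 - r.+1 = 1)%N by lia.
set A := \sum_(m < r.+1) _; set B := \sum_(s < r.+1) _.
rewrite (_ : \sum_(i < r.+1) _ = A - B); first by ring.
rewrite -sumrB; apply: eq_bigr => m _.
have mr : (m <= r)%N by rewrite -ltnS.
have -> : (r.+2 + k.+1 - m.+1 = k + r.+2 - m)%N by lia.
have -> : (r.+2 + k.+1 - m = k + r.+3 - m)%N by lia.
rewrite (subSn (leqW mr)) !mulrSr.
by ring.
Qed.

Lemma clique_step_pointed_esym r k l : clique_step r (E k.+1) l =
  \sum_(m < r.+1) ((e (k + r.+1 - m) * E m.+1 l) *+ (k - m) +
    (e m * E (k + r.+2 - m) l) *+ (r.+1 - m - (k < m) * (r.+1 - m))).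
Proof.
rewrite clique_step_pointed_esym_int.
(* For [m > k] the absorbing weight equals the reflected deficit, so these terms cancel exactly. *)
by rewrite (@sum_pointed_esym_sub k r (fun m => r.+1 - m)%N).
Qed.

End ElementaryPolynomials.

Arguments pointed_esym : simpl never.

(** * Colorings as words and transfer operators *)

Section ProperWords.
Variable T : eqType.
Implicit Types (G : lgraph) (s : seq T).

(** [onth] needs no default color and accepts words of any length, so gluing graphs becomes
    concatenating words. *)
Definition proper_word G s :=
  [forall u : 'I_(gorder G), forall v : 'I_(gorder G),
    adj u v ==> (onth s u != onth s v)].

Lemma proper_wordP G s :
  reflect (forall u v : 'I_(gorder G), adj u v -> onth s u != onth s v)
          (proper_word G s).
Proof.
apply: (iffP forallP) => [H u v uv|H u]; last first.
  by apply/forallP => v; apply/implyP; apply: H.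
by move/forallP/(_ v)/implyP: (H u); apply.
Qed.

Lemma proper_word_gsum G1 G2 s1 a s2 :
  gorder G1 = (size s1).+1 -> gorder G2 = (size s2).+1 ->
  proper_word (gsum G1 G2) (s1 ++ a :: s2) =
  proper_word G1 (rcons s1 a) && proper_word G2 (a :: s2).
Proof.
move=> n1 n2.
have oL k : (k < gorder G1)%N -> onth (s1 ++ a :: s2) k = onth (rcons s1 a) k.
  by move=> kn; rewrite -cat_rcons onth_cat size_rcons -n1 kn.
have oR k : onth (s1 ++ a :: s2) (k + (gorder G1).-1) = onth (a :: s2) k.
  by rewrite n1 onth_cat addnK ifN // -leqNgt leq_addl.
have ltL (k : 'I_(gorder G1)) : (k < (gorder G1 + gorder G2).-1)%N.
  by rewrite n2 addnS; apply: leq_trans (ltn_ord k) (leq_addr _ _).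
have ltR (k : 'I_(gorder G2)) :
    (k + (gorder G1).-1 < (gorder G1 + gorder G2).-1)%N.
  by have := ltn_ord k; lia.
apply/proper_wordP/andP => [H|[/proper_wordP H1 /proper_wordP H2] u v].
  split; apply/proper_wordP => u v uv.
    rewrite -!oL //; apply: (H (Ordinal (ltL u)) (Ordinal (ltL v))).
    by apply/orP; left; apply/existsP; exists u; apply/existsP; exists v;
      rewrite uv /= !eqxx.
  rewrite -!oR; apply: (H (Ordinal (ltR u)) (Ordinal (ltR v))).
  by apply/orP; right; apply/existsP; exists u; apply/existsP; exists v;
    rewrite uv /= !eqxx.
case/orP=> /existsP[i /existsP[j /and3P[ij /eqP-> /eqP->]]].
  by rewrite !oL //; apply: H1.
by rewrite !oR; apply: H2.
Qed.

Lemma proper_word_complete n s : size s = n ->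
  proper_word (complete_graph n) s = uniq s.
Proof.
move=> sn; apply/proper_wordP/idP => [H|us u v].
  case: s => // a s in sn H *; apply/(uniqP a) => i j.
  rewrite !inE sn => li lj ij; apply/eqP/negPn/negP => nij.
  have /negP[] := H (Ordinal li) (Ordinal lj) nij; apply/eqP => /=.
  by rewrite !onthE !(nth_map a) ?sn // ij.
apply: contra => /eqP uv; apply/eqP/val_inj.
by apply: (onth_inj _ _ _ us _ uv); rewrite gtn_min sn !ltn_ord.
Qed.

Lemma proper_word_cycle b a s : size s = b.+1 ->
  proper_word (cycle_graph b.+2) (a :: s) =
  path (fun y z => y != z) a s && (last a s != a).
Proof.
move=> sb.
have oE k : (k < b.+2)%N -> onth (a :: s) k = Some (nth a (a :: s) k).
  by move=> kb; rewrite onthE (nth_map a) //= sb.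
have lastE : last a s = nth a (a :: s) b.+1.
  by rewrite -nth_last sb /=; case: (s) sb.
apply/proper_wordP/andP => [H|[/(pathP a) Hp Hl] u v].
  have {}H (u v : 'I_b.+2) : cycle_adj u v ->
      nth a (a :: s) u != nth a (a :: s) v.
    by move/H; rewrite !oE ?ltn_ord.
  split.
    apply/(pathP a) => i; rewrite sb => ib.
    have i1 : (i < b.+2)%N by apply: ltnW.
    apply: (H (Ordinal i1) (Ordinal (ib : i.+1 < b.+2)%N)).
    by rewrite /cycle_adj -!val_eqE /= modn_small // eqxx neq_ltn ltnSn.
  rewrite lastE; apply: (H ord_max ord0).
  by rewrite /cycle_adj -!val_eqE /= modnn eqxx.
have step (w z : 'I_b.+2) : z == ordS w -> onth (a :: s) w != onth (a :: s) z.
  rewrite -val_eqE /= => /eqP zE; rewrite !oE //.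
  have := ltn_ord w; rewrite leq_eqVlt => /orP[/eqP wb|wb].
    by rewrite zE wb modnn /= -[val w]/(w : nat) -[w : nat]/(w.+1.-1) wb -lastE.
  by rewrite zE modn_small //; apply: Hp; rewrite sb -ltnS.
by case/andP=> _ /orP[/step|/step] //; rewrite eq_sym.
Qed.

End ProperWords.

Section Words.
Variables (R : comNzRingType) (I : finType) (x : I -> R).
Implicit Types (i j l : I) (G : lgraph) (s : seq I) (F : seq I -> R).

Local Notation e := (esym x).
Local Notation E := (pointed_esym x).

(** Recursion on letters, rather than a sum over tuples, avoids casts under concatenation. *)
Fixpoint word_sum n F : R :=
  if n is n'.+1 then \sum_i word_sum n' (fun s => F (i :: s)) else F [::].

Definition word_monom s : R := \prod_(i <- s) x i.

Lemma word_sumS n F :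
  word_sum n.+1 F = \sum_i word_sum n (fun s => F (i :: s)).
Proof. by []. Qed.

Lemma eq_word_sum n F F' : (forall s, size s = n -> F s = F' s) ->
  word_sum n F = word_sum n F'.
Proof.
elim: n F F' => [|n IH] F F' FF' /=; first exact: FF'.
by apply: eq_bigr => i _; apply: IH => s sn; apply: FF'; rewrite /= sn.
Qed.

Lemma word_sumZ n a F : word_sum n (fun s => a * F s) = a * word_sum n F.
Proof.
by elim: n F => //= n IH F; rewrite mulr_sumr; apply: eq_bigr => i _; rewrite IH.
Qed.

Lemma word_sum0 n F : (forall s, size s = n -> F s = 0) -> word_sum n F = 0.
Proof.
move=> F0; rewrite (@eq_word_sum _ _ (fun s => 0 * F s)).
  by rewrite word_sumZ mul0r.
by move=> s sn; rewrite F0 // mul0r.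
Qed.

Lemma exchange_word_sum n (f : seq I -> I -> R) :
  word_sum n (fun s => \sum_i f s i) = \sum_i word_sum n (f^~ i).
Proof.
elim: n f => //= n IH f; rewrite exchange_big /=.
by apply: eq_bigr => i _; rewrite IH.
Qed.

Lemma word_sum_cat a b F :
  word_sum (a + b) F = word_sum a (fun s => word_sum b (fun t => F (s ++ t))).
Proof. by elim: a F => //= a IH F; apply: eq_bigr => i _; rewrite IH. Qed.

Lemma word_sum_rcons n F :
  word_sum n.+1 F = \sum_i word_sum n (fun s => F (rcons s i)).
Proof.
elim: n F => [|n IH] F //; rewrite word_sumS.
under eq_bigr => i _ do rewrite IH.
by rewrite exchange_big.
Qed.

(* The factor of the last vertex is included here and that of the first vertex
   is excluded from [transfer], so that gluing graphs is a matrix product. *)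
Definition pointed_chromatic G j : R := word_sum (gorder G)
  (fun s => (proper_word G s && (last j s == j))%:R * word_monom s).

Definition transfer G i j : R := word_sum (gorder G).-1
  (fun s => (proper_word G (i :: s) && (last i s == j))%:R * word_monom s).

Definition word_chromatic G : R :=
  word_sum (gorder G) (fun s => (proper_word G s)%:R * word_monom s).

Lemma sum_pointed_chromatic G : (0 < gorder G)%N ->
  \sum_j pointed_chromatic G j = word_chromatic G.
Proof.
rewrite /pointed_chromatic /word_chromatic; case: (gorder G) => // n _.
rewrite -exchange_word_sum; apply: eq_word_sum => -[//|i s] _ /=.
rewrite (bigD1 (last i s)) //= eqxx andbT big1 ?addr0 // => j.
by rewrite eq_sym => /negbTE->; rewrite andbF mul0r.
Qed.

(** The first graph of a chain is seen as glued to a single vertex, whose pointed function is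
    [x]. *)
Lemma pointed_chromatic_transfer G j : (0 < gorder G)%N ->
  pointed_chromatic G j = \sum_i x i * transfer G i j.
Proof.
rewrite /pointed_chromatic /transfer; case: (gorder G) => // n _ /=.
apply: eq_bigr => i _; rewrite -word_sumZ; apply: eq_word_sum => s _.
by rewrite /word_monom big_cons mulrCA.
Qed.

Lemma pointed_chromatic_rcons G n j : gorder G = n.+1 ->
  pointed_chromatic G j = word_sum n
    (fun s => (proper_word G (rcons s j))%:R * word_monom (rcons s j)).
Proof.
move=> Gn; rewrite /pointed_chromatic Gn word_sum_rcons (bigD1 j) //=.
rewrite big1 ?addr0 => [|i /negbTE ij].
  by apply: eq_word_sum => s _; rewrite last_rcons eqxx andbT.
by apply: word_sum0 => s _; rewrite last_rcons ij andbF mul0r.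
Qed.

(** Words split at the shared vertex of color [i], whose variable is counted in the left factor
    only. *)
Lemma pointed_chromatic_gsum G1 G2 j : (0 < gorder G1)%N -> (0 < gorder G2)%N ->
  pointed_chromatic (gsum G1 G2) j =
  \sum_i pointed_chromatic G1 i * transfer G2 i j.
Proof.
case n1: (gorder G1) => [//|a] _; case n2: (gorder G2) => [//|b] _.
rewrite {1}/pointed_chromatic [gorder _](_ : _ = (a + b.+1)%N); last first.
  by rewrite /= n1 n2.
rewrite word_sum_cat /= exchange_word_sum; apply: eq_bigr => i _.
rewrite (pointed_chromatic_rcons _ n1) mulrC -word_sumZ.
apply: eq_word_sum => s1 s1a; rewrite mulrC /transfer n2 -word_sumZ.
apply: eq_word_sum => s2 s2b.
rewrite proper_word_gsum ?s1a ?s2b // last_cat /= -cat_rcons.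
rewrite /word_monom big_cat /=.
by case: proper_word; case: proper_word; case: eqP; rewrite /= ?mul0r ?mul1r ?mulr0 ?mul0r.
Qed.

(** * Operators of paths, cycles and cliques as sums over words *)

Definition path_transfer b i j : R := word_sum b
  (fun s => (path (fun y z => y != z) i s && (last i s == j))%:R * word_monom s).

Lemma path_transferS b i j :
  path_transfer b.+1 i j = \sum_(l | l != i) x l * path_transfer b l j.
Proof.
rewrite /path_transfer /= [RHS]big_mkcond; apply: eq_bigr => l _.
case: eqVneq => [_|_] /=; first by apply: word_sum0 => s _; rewrite mul0r.
rewrite -word_sumZ; apply: eq_word_sum => s _.
by rewrite /word_monom big_cons mulrCA.
Qed.

Lemma path_transfer0 i j : path_transfer 0 i j = (i == j)%:R.
Proof. by rewrite /path_transfer /= /word_monom big_nil mulr1. Qed.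

Lemma sum_delta (f : I -> R) j : \sum_i f i * (i == j)%:R = f j.
Proof.
rewrite (bigD1 j) //= eqxx mulr1 big1 ?addr0 // => i /negbTE->.
by rewrite mulr0.
Qed.

Lemma sum_path_transfer b f j :
  \sum_i f i * path_transfer b i j = iter b (path_step x) f j.
Proof.
elim: b f => [|b IH] f.
  by rewrite -[RHS]sum_delta; apply: eq_bigr => i _; rewrite path_transfer0.
rewrite iterSr -IH.
under eq_bigr => i _ do rewrite path_transferS mulr_sumr.
rewrite (exchange_big_dep xpredT) //=; apply: eq_bigr => l _.
rewrite /path_step mulr_sumr mulr_suml; apply: eq_big => [i|i _].
  by rewrite eq_sym.
by rewrite mulrCA mulrA.
Qed.

(** If the first step of a closed walk may keep its color, the path operator results; the excess is
    [x j] times a shorter closed walk, as in [cycle_pointedS]. *)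
Lemma path_transfer_closed b j :
  path_transfer b.+1 j j = cycle_pointed x b.+1 j.
Proof.
have rec n : path_transfer n.+1 j j =
    iter n (path_step x) (E 1) j - x j * path_transfer n j j.
  rewrite path_transferS.
  rewrite (@eq_iter_path_step _ _ _ _ (E 1) x); last first.
    by move=> i; rewrite pointed_esym1.
  by rewrite -sum_path_transfer [in RHS](bigD1 j) //= addrAC subrr add0r.
elim: b => [|b IH].
  rewrite rec path_transfer0 eqxx mulr1 -[iter _ _ _ _]/(E 1 j) pointed_esym1 subrr.
  by rewrite /cycle_pointed big_ord1 mulr0n.
by rewrite rec IH cycle_pointedS.
Qed.

(** The closing edge only forbids equal end colors, so the diagonal of the path operator is
    removed. *)
Lemma sum_transfer_cycle b f j :
  \sum_i f i * transfer (cycle_graph b.+2) i j =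
  iter b.+1 (path_step x) f j - f j * cycle_pointed x b.+1 j.
Proof.
have T i : transfer (cycle_graph b.+2) i j =
    (i != j)%:R * path_transfer b.+1 i j.
  rewrite -word_sumZ; apply: eq_word_sum => s sb; rewrite proper_word_cycle //.
  rewrite mulrA -natrM mulnb; congr (_%:R * _).
  by case: (last i s =P j) => [->|_]; rewrite ?andbF // !andbT andbC eq_sym.
rewrite -sum_path_transfer -path_transfer_closed [in RHS](bigD1 j) //=.
rewrite addrAC subrr add0r [RHS]big_mkcond; apply: eq_bigr => i _.
by rewrite T; case: eqP; rewrite ?mul0r ?mul1r ?mulr0.
Qed.

(** The other [r] letters form a set avoiding [j] and [B], in r! orders. The induction moves the
    first letter into [B]; [sum_elem] supplies the new factor of the factorial. *)
Lemma word_sum_uniq r (B : {set I}) j :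
  word_sum r.+1 (fun s => [&& uniq s, all (fun i => i \notin B) s
                            & last j s == j]%:R * word_monom s) =
  (j \notin B)%:R * (x j * elem x (j |: B) r) *+ r`!.
Proof.
elim: r B => [|r IH] B.
  rewrite elem0 mulr1 /= -[RHS](sum_delta (fun i => (i \notin B)%:R * x i)).
  apply: eq_bigr => i _; rewrite /word_monom big_seq1 andbT.
  by case: (i \in B); case: eqP; rewrite ?mul0r ?mul1r ?mulr0 ?mulr1.
rewrite word_sumS (eq_bigr (fun i => (i \notin B)%:R * (x i * word_sum r.+1 (fun s =>
    [&& uniq s, all (fun k => k \notin i |: B) s
      & last j s == j]%:R * word_monom s)))); last first.
  move=> i _; rewrite -!word_sumZ; apply: eq_word_sum => -[//|k s] _.
  rewrite (_ : last j [:: i, k & s] = last j (k :: s)) //.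
  move: (k :: s) => {k s} t; rewrite {1}/word_monom big_cons -/(word_monom t).
  have -> : all (fun k => k \notin i |: B) t =
      (i \notin t) && all (fun k => k \notin B) t.
    elim: t => //= y t ->; rewrite !inE !negb_or [i == y]eq_sym.
    by case: (y == i); case: (y \in B); case: (i \in t).
  rewrite [uniq (i :: _)]/= [all _ (i :: _)]/=.
  case: (i \in t); case: (i \in B); case: (uniq t); case: (all _ t);
  by case: (_ == j); rewrite /= ?(mul0r, mul1r, mulr0).
under eq_bigr => i _ do rewrite IH.
have [jB|jB] := boolP (j \in B).
  rewrite mul0r mul0rn big1 // => i _.
  by rewrite !inE jB orbT mul0r mul0rn !mulr0.
rewrite mul1r factS mulrnA -mulrnAr -sum_elem mulr_sumr -sumrMnl.
rewrite [RHS]big_mkcond; apply: eq_bigr => i _.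
rewrite !inE negb_or jB andbT negb_or eq_sym [in RHS]setUCA.
by case: eqVneq => _ /=; case: (i \in B) => /=; ring.
Qed.

Lemma sum_transfer_clique r f j :
  \sum_i f i * transfer (complete_graph r.+2) i j =
  clique_step x r f j *+ r`!.
Proof.
rewrite /clique_step mulr_sumr -sumrMnl [RHS]big_mkcond; apply: eq_bigr => i _.
rewrite (_ : transfer _ i j =
    (j \notin [set i])%:R * (x j * elem x (j |: [set i]) r) *+ r`!); last first.
  rewrite -word_sum_uniq; apply: eq_word_sum => -[//|k s] sr.
  rewrite proper_word_complete; last by congr S; exact: sr.
  rewrite (eq_all (a2 := predC (pred1 i))) => [|y]; last by rewrite inE.
  by rewrite all_predC has_pred1 cons_uniq -andbA andbCA.
rewrite !inE eq_sym [[set j; i]]setUC; case: eqVneq => _ /=.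
  by rewrite mul0r mul0rn mulr0.
by ring.
Qed.

Lemma sum_transfer_single f j :
  \sum_i f i * transfer (complete_graph 1) i j = f j.
Proof.
rewrite -[RHS]sum_delta; apply: eq_bigr => i _; congr (_ * _).
by rewrite /transfer /= proper_word_complete //= /word_monom big_nil mulr1.
Qed.

End Words.

(** * Pointed e-positivity *)

Section PointedPositivity.
Variable R : comNzRingType.

(** The list may be unsorted and contain zeros; [partition_of] normalizes it later. *)
Definition esym_prod (I : finType) (x : I -> R) (l : seq nat) : R :=
  \prod_(k <- l) esym x k.

Definition pointed_family := forall I : finType, (I -> R) -> I -> R.
Implicit Types F : pointed_family.

(* The expansion is required to be the same for all finite sets of variables. *)
Definition pointed_e_positive n F := exists L : seq (nat * seq nat),
  all (fun p => p.1 + sumn p.2 == n)%N L /\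
  forall I x j,
    F I x j = \sum_(p <- L) pointed_esym x p.1 j * esym_prod x p.2.
Arguments pointed_e_positive n%_N F.
Local Notation pos := pointed_e_positive.

Lemma eq_pos n F F' : (forall I x j, F I x j = F' I x j) -> pos n F -> pos n F'.
Proof. by move=> FF' [L [Ln FL]]; exists L; split=> // I x j; rewrite -FF'. Qed.

Lemma pos0 n : pos n (fun _ _ _ => 0).
Proof. by exists [::]; split=> // I x j; rewrite big_nil. Qed.

Lemma posD n F F' : pos n F -> pos n F' -> pos n (fun I x j => F I x j + F' I x j).
Proof.
move=> [L [Ln FL]] [L' [Ln' FL']]; exists (L ++ L').
by split=> [|I x j]; rewrite ?all_cat ?Ln // big_cat FL FL'.
Qed.

Lemma posMn n F a : pos n F -> pos n (fun I x j => F I x j *+ a).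
Proof.
move=> Fn; elim: a => [|a IH].
  by apply: eq_pos (pos0 n) => I x j; rewrite mulr0n.
by apply: eq_pos (posD Fn IH) => I x j; rewrite mulrS.
Qed.

Lemma pos_sum_seq (T : Type) (P : T -> Prop) (r : seq T) n
    (F : T -> pointed_family) :
  List.Forall P r -> (forall t, P t -> pos n (F t)) ->
  pos n (fun I x j => \sum_(t <- r) F t I x j).
Proof.
move=> Pr PF; elim: Pr => [|t {}r Pt _ IH].
  by apply: eq_pos (pos0 n) => I x j; rewrite big_nil.
by apply: eq_pos (posD (PF t Pt) IH) => I x j; rewrite big_cons.
Qed.

Lemma pos_sum b n (F : nat -> pointed_family) :
  (forall m, (m < b)%N -> pos n (F m)) ->
  pos n (fun I x j => \sum_(m < b) F m I x j).
Proof.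
elim: b => [|b IH] Fn.
  by apply: eq_pos (pos0 n) => I x j; rewrite big_ord0.
apply: eq_pos (posD (IH _) (Fn b _)) => // [I x j|m mb].
  by rewrite big_ord_recr.
by apply: Fn; apply: ltnW.
Qed.

Lemma pos_pointed_esym n : pos n (fun I x j => pointed_esym x n j).
Proof.
exists [:: (n, [::])]; split=> [|I x j]; first by rewrite /= addn0 eqxx.
by rewrite big_seq1 /esym_prod big_nil mulr1.
Qed.

Lemma pos_esymM k n F : pos n F -> pos (k + n) (fun I x j => esym x k * F I x j).
Proof.
move=> [L [Ln FL]]; exists [seq (p.1, k :: p.2) | p <- L]; split=> [|I x j].
  by rewrite all_map; apply: sub_all Ln => p /= /eqP <-; rewrite addnCA.
rewrite big_map FL mulr_sumr; apply: eq_bigr => p _ /=.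
by rewrite /esym_prod big_cons mulrCA.
Qed.

Lemma pos_esym_prodM l n F :
  pos n F -> pos (sumn l + n) (fun I x j => esym_prod x l * F I x j).
Proof.
move=> Fn; elim: l => [|k l IH].
  by apply: eq_pos Fn => I x j; rewrite /esym_prod big_nil mul1r.
rewrite -[sumn (k :: l)]/(k + sumn l)%N -addnA; apply: eq_pos (pos_esymM k IH) => I x j.
by rewrite /esym_prod big_cons mulrA.
Qed.

(** The recursion [path_coefS] has natural numbers as coefficients. *)
Lemma pos_path_coefM a n F :
  pos n F -> pos (a + n) (fun I x j => path_coef x a * F I x j).
Proof.
move=> Fn; elim/ltn_ind: a => -[_|a IH].
  by apply: eq_pos Fn => I x j; rewrite /path_coef mul1r.
apply: (@eq_pos _ (fun I x j => \sum_(i < a.+1)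
    (esym x i.+1 * (path_coef x (a - i) * F I x j)) *+ i)).
  move=> I x j; rewrite path_coefS mulr_suml; apply: eq_bigr => i _.
  by rewrite -mulrnAl mulrA !mulrnAl.
apply: (@pos_sum _ _ (fun i I x j =>
    (esym x i.+1 * (path_coef x (a - i) * F I x j)) *+ i)) => i ia.
apply: posMn; have -> : (a.+1 + n = i.+1 + (a - i + n))%N by lia.
by apply: pos_esymM; apply: IH; lia.
Qed.

Definition transfer_family (F : pointed_family) G : pointed_family :=
  fun I x j => \sum_i F I x i * transfer x G i j.

Lemma pos_esym_pair (a b n : nat) : (a + b = n)%N ->
  pos n (fun I x j => esym x a * pointed_esym x b j).
Proof. by move=> <-; apply/pos_esymM/pos_pointed_esym. Qed.

Lemma pos_transfer_pointed_esym k G : clique_or_cycle G ->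
  pos (k + (gorder G).-1) (transfer_family (fun I x => pointed_esym x k) G).
Proof.
case: k => [|k] GH.
  apply: eq_pos (pos0 _) => I x j.
  by rewrite /transfer_family big1 // => i _; rewrite mul0r.
(* The remaining graphs are [K_1], [K_(b+2)] and [C_(b+2)]. *)
case: GH => -[[//|[|b]] // _ ->]; rewrite [gorder _]/=.
- rewrite addn0; apply: eq_pos (pos_pointed_esym _) => I x j.
  by rewrite /transfer_family sum_transfer_single.
- apply: (@eq_pos _ (fun I x j => (\sum_(m < b.+1)
      ((esym x (k + b.+1 - m) * pointed_esym x m.+1 j) *+ (k - m) +
       (esym x m * pointed_esym x (k + b.+2 - m) j) *+
         (b.+1 - m - (k < m) * (b.+1 - m)))) *+ b`!)).
    move=> I x j.
    by rewrite -clique_step_pointed_esym -sum_transfer_clique.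
  apply: posMn; apply: (@pos_sum _ _ (fun m I x j =>
      (esym x (k + b.+1 - m) * pointed_esym x m.+1 j) *+ (k - m) +
      (esym x m * pointed_esym x (k + b.+2 - m) j) *+
        (b.+1 - m - (k < m) * (b.+1 - m)))) => m mb.
  by apply: posD; apply: posMn; apply: pos_esym_pair; lia.
pose D i : pointed_family := fun I x j => \sum_(m < i.+1)
  ((esym x (k + i.+1 - m) * pointed_esym x m.+1 j) *+ (k - m) +
   (esym x m * pointed_esym x (k + i.+2 - m) j) *+ (i - (k < m) * (i.+1 - m))).
apply: (@eq_pos _ (fun I x j => pointed_esym x (k + b.+1).+1 j +
    \sum_(i < b.+1) path_coef x (b.+1 - i.+1) * D i I x j)).
  move=> I x j; rewrite /transfer_family sum_transfer_cycle.
  by rewrite cycle_step_pointed_esym.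
apply: posD; first exact: pos_pointed_esym.
apply: (@pos_sum _ _ (fun i I x j => path_coef x (b.+1 - i.+1) * D i I x j)).
move=> i ib.
have -> : (k.+1 + b.+1 = b.+1 - i.+1 + (k + i.+2))%N by lia.
apply: pos_path_coefM; apply: (@pos_sum _ _ (fun m I x j =>
  (esym x (k + i.+1 - m) * pointed_esym x m.+1 j) *+ (k - m) +
  (esym x m * pointed_esym x (k + i.+2 - m) j) *+
    (i - (k < m) * (i.+1 - m)))) => m mi.
by apply: posD; apply: posMn; apply: pos_esym_pair; lia.
Qed.

(** Transfer operators are linear over the symmetric functions. *)
Lemma pos_transfer n F G : clique_or_cycle G -> pos n F ->
  pos (n + (gorder G).-1) (transfer_family F G).
Proof.
move=> GH [L [/allP Ln FL]].
apply: (@eq_pos _ (fun I x j => \sum_(p <- L) esym_prod x p.2 *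
    transfer_family (fun I x => pointed_esym x p.1) G x j)).
  move=> I x j; rewrite /transfer_family.
  under [RHS]eq_bigr => i _ do rewrite FL mulr_suml.
  rewrite exchange_big; apply: eq_bigr => p _; rewrite mulr_sumr.
  by apply: eq_bigr => i _; rewrite mulrCA mulrA.
apply: (@pos_sum_seq _ (fun p => p.1 + sumn p.2 = n)%N L _ (fun p I x j =>
    esym_prod x p.2 * transfer_family (fun I x => pointed_esym x p.1) G x j)).
  by apply/List.Forall_forall => p pL; apply/eqP/Ln; elim: (L) pL => //= q r IH
    [->|/IH pr]; rewrite inE ?eqxx ?pr ?orbT.
move=> [k l] /= <-; rewrite addnAC [X in pos X]addnC.
exact/pos_esym_prodM/pos_transfer_pointed_esym.
Qed.

Lemma clique_or_cycle_order G : clique_or_cycle G -> (0 < gorder G)%N.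
Proof. by case=> -[n n0 ->] //; apply: ltnW. Qed.

Lemma foldl_gsum_pos (Gs : seq lgraph) G : List.Forall clique_or_cycle Gs ->
  (0 < gorder G)%N -> pos (gorder G) (fun I x j => pointed_chromatic x G j) ->
  let H := foldl gsum G Gs in
  (0 < gorder H)%N /\ pos (gorder H) (fun I x j => pointed_chromatic x H j).
Proof.
move=> GsP; elim: GsP G => //= H {}Gs HP _ IH G G0 GP; apply: IH.
  by have := clique_or_cycle_order HP; rewrite /=; lia.
have H0 := clique_or_cycle_order HP.
have -> : gorder (gsum G H) = (gorder G + (gorder H).-1)%N by rewrite /=; lia.
apply: eq_pos (pos_transfer HP GP) => I x j.
by rewrite pointed_chromatic_gsum.
Qed.

Lemma gchain_pos (Gs : seq lgraph) : List.Forall clique_or_cycle Gs ->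
  (0 < size Gs)%N -> let H := gchain Gs in
  (0 < gorder H)%N /\ pos (gorder H) (fun I x j => pointed_chromatic x H j).
Proof.
case=> // G {}Gs GP GsP _; apply: foldl_gsum_pos => //.
  exact: clique_or_cycle_order.
have G0 := clique_or_cycle_order GP.
have -> : gorder G = (1 + (gorder G).-1)%N by lia.
apply: eq_pos (pos_transfer GP (pos_pointed_esym 1)) => I x j.
rewrite pointed_chromatic_transfer //; apply: eq_bigr => i _.
by rewrite pointed_esym1.
Qed.

Lemma word_chromatic_gchain (Gs : seq lgraph) : List.Forall clique_or_cycle Gs ->
  (0 < size Gs)%N -> exists L : seq (seq nat),
    all (fun l => sumn l == gorder (gchain Gs)) L /\
    forall (I : finType) (x : I -> R),
      word_chromatic x (gchain Gs) = \sum_(l <- L) esym_prod x l.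
Proof.
move=> GsP Gs0; have [H0 [L [/allP LH HL]]] := gchain_pos GsP Gs0.
(* Since [E_k] sums to [k e_k] over the colors, a term of index [k] yields [k] copies of the list
   extended by [k]. *)
exists (flatten [seq nseq p.1 (p.1 :: p.2) | p <- L]); split=> [|I x].
  apply/allP => l /flatten_mapP[p pL] /nseqP[-> _] /=; exact: LH.
rewrite -sum_pointed_chromatic // big_flatten big_map.
rewrite (eq_bigr _ (fun j _ => HL I x j)).
rewrite exchange_big; apply: eq_bigr => p _.
rewrite -mulr_suml sum_pointed_esym big_nseq iter_addr_0.
by rewrite /esym_prod big_cons mulrnAl.
Qed.

End PointedPositivity.

(** * From polynomials to power series *)

(** The image of [h] contains the support of [f] on [A]. *)
Lemma fsum_image (I : choiceType) (J : finType) (h : J -> I) (P : pred J)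
    (A : set I) (f : I -> rat) :
  injective h -> (forall j, reflect (A (h j)) (P j)) ->
  (forall i, A i -> f i != 0 -> exists j, h j = i) ->
  (\sum_(i \in A) f i)%R = \sum_(j | P j) f (h j).
Proof.
move=> h_inj PA fA; rewrite (fsbigE [seq h j | j <- enum P]).
- rewrite big_map big_enum_cond /=; apply: eq_bigl => j.
  by apply/andP/idP => [[]|Pj] //; split=> //; apply/mem_set/PA.
- by rewrite map_inj_uniq ?enum_uniq.
- by move=> i /= /mapP[j]; rewrite mem_enum => /PA Aj ->.
move=> i Ai; apply: contraNeq => /(fA _ Ai)[j ji].
by apply/mapP; exists j; rewrite // mem_enum; apply/PA; rewrite ji.
Qed.

Section WordsAsFunctions.
Variables (R : comNzRingType) (I : finType) (x : I -> R).

Lemma word_sum_tuple n (F : seq I -> R) :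
  word_sum n F = \sum_(t : n.-tuple I) F t.
Proof.
elim: n F => [|n IH] F.
  by rewrite (big_pred1 [tuple]) // => t; symmetry; apply/eqP/tuple0.
rewrite word_sumS; under eq_bigr => i _ do rewrite IH.
rewrite pair_bigA /= (reindex (fun t : n.+1.-tuple I => (thead t, [tuple of behead t]))) /=.
  by apply: eq_bigr => t _; rewrite [in RHS](tuple_eta t).
exists (fun p : I * n.-tuple I => [tuple of p.1 :: p.2]) => [t _|[i t] _] /=.
  by rewrite -tuple_eta.
by rewrite theadE; congr pair; apply/val_inj.
Qed.

Lemma word_chromaticE G : word_chromatic x G =
  \sum_(g : {ffun 'I_(gorder G) -> I} | [forall u, forall v, adj u v ==> (g u != g v)])
    \prod_v x (g v).
Proof.
rewrite /word_chromatic word_sum_tuple [RHS]big_mkcond /=.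
rewrite (reindex (fun g : {ffun 'I_(gorder G) -> I} => [tuple g i | i < _])).
  apply: eq_bigr => g _; rewrite /word_monom big_tuple.
  rewrite [in LHS](eq_bigr (fun v => x (g v))) => [|v _]; last first.
    by rewrite tnth_mktuple.
  have -> : proper_word G [tuple g i | i < _] =
      [forall u, forall v, adj u v ==> (g u != g v)].
    have oE (u : 'I_(gorder G)) : onth [tuple g i | i < _] u = Some (g u).
      by apply/tnth_onth; rewrite tnth_mktuple.
    by do 2![apply: eq_forallb => ?]; rewrite !oE.
  by case: ifP; rewrite ?mul1r ?mul0r.
exists (fun t => [ffun i => tnth t i]) => [g _|t _].
  by apply/ffunP => i; rewrite ffunE tnth_mktuple.
by apply: eq_from_tnth => i; rewrite tnth_mktuple ffunE.
Qed.

End WordsAsFunctions.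

(* On monomials in the variables indexed by D, the power series over all the
   variables agree with the polynomials in these variables alone. *)
Section Truncation.
Variable D : {fset nat}.
Local Notation poly := {malg rat[xmonomial]}.

Definition trunc_var (i : D) : poly := << ucm (val i) >>.
Local Notation x := trunc_var.

Lemma prod_monom (J : Type) (r : seq J) (P : pred J) (f : J -> xmonomial) :
  \prod_(j <- r | P j) (<< f j >> : poly) = << \big[mmul/mone]_(j <- r | P j) f j >>.
Proof.
elim/big_rec2: _ => [|j m y _ ->].
  by rewrite -mpolyC1E.
by rewrite malgM_def fgmulUU mulr1.
Qed.

(** A coloring with monomial [m] uses only colors in [finsupp m], so it factors through [D]. *)
Lemma coef_word_chromatic (G : lgraph) (m : xmonomial) : (finsupp m `<=` D)%fset ->
  (word_chromatic x G)@_m = chromatic G m.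
Proof.
move=> mD; rewrite word_chromaticE raddf_sum /= /chromatic /fps_sum.
rewrite (fsum_image (h := fun g : {ffun _ -> D} => [ffun v => val (g v)])
  (P := fun g => [forall u, forall v, adj u v ==> (g u != g v)])).
- apply: eq_bigr => g _; rewrite prod_monom mcoeffU1; congr (_ == _)%:R.
  by apply: eq_bigr => v _; rewrite ffunE.
- move=> g g' /ffunP gg'; apply/ffunP => v; apply/val_inj.
  by have := gg' v; rewrite !ffunE.
- move=> g; apply: (iffP forallP) => /= H u => [v uv|].
    by have := forallP (H u) v; rewrite uv !ffunE (inj_eq val_inj).
  apply/forallP => v; apply/implyP => /H.
  by rewrite !ffunE (inj_eq val_inj).
move=> k /= _; rewrite pnatr_eq0 eqb0 negbK => /eqP km.
have kD v : k v \in D.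
  apply: (fsubsetP mD); rewrite -cmE_neq0 -km prod_ucmE -lt0n -has_count.
  by apply/hasP; exists v; rewrite ?mem_index_enum.
exists [ffun v => [` kD v]%fset]; by apply/ffunP => v; rewrite !ffunE.
Qed.

Lemma coef_esym k (m : xmonomial) : (finsupp m `<=` D)%fset ->
  (esym x k)@_m = elementary k m.
Proof.
move=> mD; rewrite /esym /elem raddf_sum /= /elementary /fps_sum.
rewrite (fsum_image (h := fun A : {set D} => [fset val i | i in A]%fset)
  (P := fun A => #|A| == k)).
- apply: eq_big => [A|A _].
    by rewrite disjoint_sym disjoints_subset sub0set andbT.
  rewrite prod_monom mcoeffU1; congr (_ == _)%:R.
  rewrite /subset_monomial big_imfset /=; last by move=> ? ? _ _; apply: val_inj.
  by rewrite -big_enum.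
- move=> A B AB; apply/setP => i; apply/idP/idP => iA.
    have : val i \in [fset val i | i in B]%fset by rewrite -AB; apply: in_imfset.
    by case/imfsetP => j /= jB /val_inj ->.
  have : val i \in [fset val i | i in A]%fset by rewrite AB; apply: in_imfset.
  by case/imfsetP => j /= jB /val_inj ->.
- move=> A; rewrite /= card_imfset /=; last exact: val_inj.
  by rewrite -cardE; exact: eqP.
move=> S /= _; rewrite pnatr_eq0 eqb0 negbK => /eqP Sm.
have SD i : i \in S -> i \in D.
  move=> iS; apply: (fsubsetP mD); rewrite -cmE_neq0 -Sm (prod_ucmE _ id).
  by rewrite -lt0n -has_count; apply/hasP; exists i.
exists [set i : D | val i \in S]; apply/fsetP => i.
apply/imfsetP/idP => [[j /=]|iS]; first by rewrite inE => jS ->.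
by exists [` SD _ iS]%fset; rewrite //= inE.
Qed.

(** The factors of a monomial in the variables of [D] involve only these variables, so both
    hypotheses apply to them. *)
Lemma coef_mul (f g : fps) (F G : poly) :
  (forall m : xmonomial, (finsupp m `<=` D)%fset -> F@_m = f m) ->
  (forall m : xmonomial, (finsupp m `<=` D)%fset -> G@_m = g m) ->
  forall m : xmonomial, (finsupp m `<=` D)%fset -> (F * G)@_m = fps_mul f g m.
Proof.
move=> Ff Gg m mD; rewrite mcoeffMl /fps_mul.
have supp (p : xmonomial * xmonomial) : mmul p.1 p.2 = m ->
    ((finsupp p.1 `<=` D) && (finsupp p.2 `<=` D))%fset.
  by move=> pm; move: mD; rewrite -pm mdomD fsubUset.
rewrite (fsum_image (h := fun p : msupp F * msupp G => (val p.1, val p.2))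
  (P := fun p => mmul (val p.1) (val p.2) == m)).
- transitivity (\sum_(p : msupp F) \sum_(q : msupp G)
      if mmul (val p) (val q) == m then f (val p) * g (val q) else 0); last first.
    by rewrite pair_bigA [RHS]big_mkcond.
  rewrite big_seq_fsetE; apply: eq_bigr => p _ /=.
  rewrite big_seq_fsetE; apply: eq_bigr => q _ /=.
  case: eqP => [/(supp (val p, val q))/andP[pD qD]|_]; last by rewrite mulr0n.
  by rewrite mulr1n Ff ?Gg.
- by move=> [p q] [p' q'] [/val_inj-> /val_inj->].
- by move=> p; exact: eqP.
move=> p /supp/andP[pD qD]; rewrite -Ff // -Gg // mulf_eq0 negb_or !mcoeff_neq0.
by case: p {pD qD} => p q /andP[/= pF qG]; exists ([` pF]%fset, [` qG]%fset).
Qed.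

Lemma coef_esym_prod l (m : xmonomial) : (finsupp m `<=` D)%fset ->
  (esym_prod x l)@_m = elementary_part l m.
Proof.
elim: l m => [|k l IH] m mD.
  by rewrite /esym_prod big_nil mcoeff1.
rewrite /esym_prod big_cons /elementary_part /=.
by apply: coef_mul mD => p pD; [exact: coef_esym | exact: IH].
Qed.

End Truncation.

(** Zeros may be dropped because [e_0 = 1]. *)
Definition partition_of (l : seq nat) := sort geq [seq k <- l | (0 < k)%N].

Lemma partition_ofP n l : sumn l = n -> is_partition n (partition_of l).
Proof.
move=> <-; rewrite /partition_of; apply/and3P; split.
- by apply: sort_sorted => a b; rewrite /geq /=; exact: leq_total.
- by rewrite all_sort; apply/allP => k; rewrite mem_filter => /andP[].
rewrite (perm_sumn (permEl (perm_sort _ _))); apply/eqP.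
by elim: l => //= -[|k] l IH /=; rewrite IH.
Qed.

Lemma esym_prod_partition_of (R : comNzRingType) (I : finType) (x : I -> R) l :
  esym_prod x (partition_of l) = esym_prod x l.
Proof.
rewrite /esym_prod (perm_big _ (permEl (perm_sort _ _))) /= big_filter.
rewrite big_mkcond; apply: eq_bigr => -[|k] _ //=.
by rewrite /esym elem0.
Qed.

Lemma e_positive_of_word_chromatic (G : lgraph) (L : seq (seq nat)) :
  all (fun l => sumn l == gorder G) L ->
  (forall (I : finType) (x : I -> {malg rat[xmonomial]}),
    word_chromatic x G = \sum_(l <- L) esym_prod x l) ->
  e_positive G.
Proof.
move=> /allP LG XG; pose M := [seq partition_of l | l <- L].
(* Coefficients are recorded in [L] by repetition, hence the multiplicity. *)
exists (fun l => (count_mem l M)%:R); split; last by move=> l _; apply: ler0n.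
apply/funext => m; rewrite /e_combination (fsbigE (undup M)) ?undup_uniq //.
(* As [L] does not depend on the variables, they can be chosen as those occurring in [m]. *)
- rewrite -(@coef_word_chromatic (finsupp m)) // XG raddf_sum /=.
  transitivity (\sum_(l <- M) elementary_part l m).
    rewrite big_map; apply: eq_bigr => l _.
    by rewrite -esym_prod_partition_of coef_esym_prod.
  transitivity (\sum_(l <- undup M) elementary_part l m *+ count_mem l M).
    symmetry; exact: (@big_undup_iterop_count _ _ _ _ M xpredT).
  have MG l : l \in undup M -> is_partition (gorder G) l.
    by rewrite mem_undup => /mapP[l' l'L ->]; apply/partition_ofP/eqP/LG.
  rewrite [LHS]big_seq [RHS]big_seq_cond; apply: eq_big => [l|l _].
    by symmetry; apply: andb_idr => /MG lG; apply/mem_set.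
  by rewrite mulr_natl.
- move=> l /=; rewrite mem_undup => /mapP[l' l'L ->].
  exact/partition_ofP/eqP/LG.
move=> l _; rewrite mem_undup => lM.
by rewrite (count_memPn lM) mul0r.
Qed.

Theorem mainTheorem3 (m : nat) (hm : (1 <= m)%N) (G : 'I_m -> lgraph)
  (hG : forall i : 'I_m, clique_or_cycle (G i)) :
  e_positive (gchain [seq G i | i <- enum 'I_m]).
Proof.
have GP : List.Forall clique_or_cycle [seq G i | i <- enum 'I_m].
  by elim: (enum 'I_m) => //= i r; constructor.
have G0 : (0 < size [seq G i | i <- enum 'I_m])%N.
  by rewrite size_map size_enum_ord.
have [L [LG XG]] := @word_chromatic_gchain {malg rat[xmonomial]} _ GP G0.
exact: e_positive_of_word_chromatic LG XG.
Qed.
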